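(* Let $\bm{\pi}^e$ be the subchannel assigning vector of all real and virtual users. If for every BS $m\in\mathcal{M}$ there is no negative differ-group loop in the weighted directed graph $G^m(\mathcal{V}^e,\mathcal{E}^e,\mathcal{W}^e;\bm{\pi}^e)$, then the user grouping strategy based on $\bm{\pi}^e$ is an all-stable solution.
   Context: System: $\mathcal{M}=\{1,\dots,M\}$ base stations (BSs), $\mathcal{N}=\{1,\dots,N\}$ (real) users, $\mathcal{G}=\{1,\dots,G\}$ channels available in every BS. Each user is associated with one fixed BS; $\mathcal{U}^m$ is the set of users of BS $m$. A subchannel assigning vector $\bm{\pi}$ assigns to each user $n$ a channel $\pi_n\in\mathcal{G}$; the group $mg$ is $\mathcal{U}^{m,g}=\{n\in\mathcal{U}^m:\pi_n=g\}$. $H^{m,g}_n\ne0$ is the channel coefficient between BS $m$ and user $n$ on channel $g$, $\sigma^2>0$ the noise power, $r_n\ge0$ the target rate of user $n$. Virtual users: for each group of each BS one virtual user is added, associated with that BS and initially assigned to that group, with target rate $0$ (and arbitrary nonzero channel coefficients). $\bm{\pi}^e$ is the subchannel assigning vector of all real and virtual users, in which each group contains exactly its one virtual user together with its real users. Power: the powers $p_n\ge0$ under an assignment are the solution of $$p_n=(2^{r_n}-1)\Big(\frac{I_n+\sigma^2}{|H^{m,g}_n|^2}+\sum_{i\in\mathcal{U}^{m,g}:\,S^{m,g}_i>S^{m,g}_n}p_i\Big),\quad n\in\mathcal{U}^{m,g},$$ where $I_n=\sum_{m'\ne m}|H^{m',g}_n|^2\sum_{j\in\mathcal{U}^{m',g}}p_j$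 and $S^{m,g}_n=|H^{m,g}_n|^2/(I_n+\sigma^2)$ (ties in $S$ broken by a fixed labelling of users, $S_i>S_n$ meaning $i$ comes after $n$). Such a solution is assumed to exist for every assignment; virtual users get power $0$. $P^g$ denotes the total power of all users (in all BSs) assigned to channel $g$; it depends only on which users are assigned to $g$. The total transmit power is $P_t=\sum_{g\in\mathcal{G}}P^g$. Moves: $(n\rightarrow g)$ means moving user $n$ to channel $g$ within its BS. All channels $\pi_{n_k}$ appearing below are those before any move, and listed moves are carried out simultaneously. Leagues: users $n_1,\dots,n_i$ in pairwise different groups of one BS compose an $i$-shift league if performing $(n_1\rightarrow\pi_{n_2}),\dots,(n_{i-1}\rightarrow\pi_{n_i})$ strictly decreases $P_t$; they compose an $i$-exchange league if performing $(n_1\rightarrow\pi_{n_2}),\dots,(n_{i-1}\rightarrow\pi_{n_i}),(n_i\rightarrow\pi_{n_1})$ strictly decreases $P_t$. A grouping is an all-stable solution if for every $i\in\mathcal{N}=\{1,\dots,N\}$ there is no $i$-shift league and no $i$-exchange league in any BS. Graph: $G^m(\mathcal{V}^e,\mathcal{E}^e,\mathcal{W}^e;\bm{\pi}^e)$ has as nodes the real and virtual users of BS $m$; there is an edge $n\to\tilde n$ iff $\pi_n\ne\pi_{\tilde n}$, with weight $$\bigtriangleup^{\pi_{\tilde n}}(n\twoheadrightarrow\tilde n)=P^{\pi_{\tilde n}}\big|_{\text{after}}-P^{\pi_{\tilde n}}\big|_{\text{before}},$$ where ''before'' refers to the current assignment, and ''after'' to the set of users on channel $\pi_{\tilde n}$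 obtained by adding $n$ and removing $\tilde n$. A negative differ-group loop is a directed cycle $n_1\to n_2\to\cdots\to n_i\to n_1$ in this graph whose users lie in pairwise different groups and whose sum of edge weights is negative. *)

(* Defs.v *)
(* MathComp / MathComp-Analysis. *)
From HB Require Import structures.
From mathcomp Require Import all_boot all_order all_algebra.
From mathcomp Require Import complex.
From mathcomp Require Import classical_sets reals exp.

Set Implicit Arguments.
Unset Strict Implicit.
Unset Printing Implicit Defensive.

Import Order.TTheory GRing.Theory Num.Theory.
Local Open Scope ring_scope.

(* The user type U is a parameter so that the definitions below apply both to
   the real users alone and to the real users together with the virtual ones.
   [label] is the labelling breaking ties in the decoding order. *)
Record network (R : realType) (M G : nat) (U : finType) := Network {
  bs : U -> 'I_M;
  coef : 'I_M -> 'I_G -> U -> R[i];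
  noise : R;
  rate : U -> R;
  label : U -> nat
}.

Definition valid_network (R : realType) (M G : nat) (U : finType)
    (net : network R M G U) : Prop :=
  [/\ forall m g n, coef net m g n != 0,
      0 < noise net,
      forall n, 0 <= rate net n
    & injective (label net)].

Section Power.
Variables (R : realType) (M G : nat) (U : finType) (net : network R M G U).

Definition gain (m : 'I_M) (g : 'I_G) (n : U) : R := Normc.normc (coef net m g n) ^+ 2.

(* In the next four definitions A is the set of users assigned to channel g
   in all the base stations; the group mg is then {n in A | bs n = m}. *)

Definition interference (g : 'I_G) (A : {set U}) (p : {ffun U -> R}) (n : U) : R :=
  \sum_(m < M | m != bs net n)
     gain m g n * \sum_(j in A | bs net j == m) p j.

Definition sinr (g : 'I_G) (A : {set U}) (p : {ffun U -> R}) (n : U) : R :=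
  gain (bs net n) g n / (interference g A p n + noise net).

Definition stronger (g : 'I_G) (A : {set U}) (p : {ffun U -> R}) (i n : U) : bool :=
  (sinr g A p n < sinr g A p i)
  || (sinr g A p i == sinr g A p n) && (label net n < label net i)%N.

Definition is_power (g : 'I_G) (A : {set U}) (p : {ffun U -> R}) : Prop :=
  forall n, n \in A ->
    0 <= p n /\
    p n = (2 `^ rate net n - 1) *
          ((interference g A p n + noise net) / gain (bs net n) g n
           + \sum_(i in A | (bs net i == bs net n) && stronger g A p i n) p i).

(* P^g when A is the set of users on channel g.  In a valid network the
   solution is unique on A, so the choice made by [xget] is immaterial. *)
Definition chan_power (g : 'I_G) (A : {set U}) : R :=
  \sum_(n in A) (xget [ffun=> 0] [set p | is_power g A p]%classic : {ffun U -> R}) n.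

Definition on_channel (pi : {ffun U -> 'I_G}) (g : 'I_G) : {set U} :=
  [set n | pi n == g].

Definition feasible : Prop :=
  forall pi : {ffun U -> 'I_G}, exists p : {ffun U -> R},
    forall g, is_power g (on_channel pi g) p.

Definition total_power (pi : {ffun U -> 'I_G}) : R :=
  \sum_(g < G) chan_power g (on_channel pi g).

End Power.

Section Stability.
Variables (R : realType) (M G : nat) (U : finType) (net : network R M G U).
Implicit Types (pi : {ffun U -> 'I_G}) (m : 'I_M) (s : seq U).

(* For s = [:: n_1; ...; n_i] without repetition, [next s] maps n_k to
   n_{k+1} and n_i to n_1, and fixes the users outside s. *)

Definition exchange pi s : {ffun U -> 'I_G} := [ffun n => pi (next s n)].

Definition shift pi s : {ffun U -> 'I_G} :=
  [ffun n => if n == last n s then pi n else pi (next s n)].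

(* Within one base station, groups are different iff channels are. *)
Definition differ_group pi m s : Prop :=
  (forall n, n \in s -> bs net n = m) /\ uniq [seq pi n | n <- s].

Definition shift_league pi m (i : nat) s : Prop :=
  [/\ size s = i, differ_group pi m s
    & total_power net (shift pi s) < total_power net pi].

Definition exchange_league pi m (i : nat) s : Prop :=
  [/\ size s = i, differ_group pi m s
    & total_power net (exchange pi s) < total_power net pi].

Definition all_stable pi : Prop :=
  forall i : nat, (1 <= i <= #|U|)%N -> forall m s,
    ~ shift_league pi m i s /\ ~ exchange_league pi m i s.

Definition edge pi m : rel U :=
  [rel n n' | [&& bs net n == m, bs net n' == m & pi n != pi n']].

Definition weight pi (n n' : U) : R :=
  let g := pi n' in
  chan_power net g (n |: (on_channel pi g :\ n')) - chan_power net g (on_channel pi g).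

Definition negative_differ_group_loop pi m s : Prop :=
  [/\ cycle (edge pi m) s, differ_group pi m s
    & \sum_(n <- s) weight pi n (next s n) < 0].

End Stability.

(* Real users are [inl n]; [inr (m, h)] is the h-th virtual user of base
   station m, with coefficients Hv and tie-breaking label lv. *)
Definition with_virtual (R : realType) (M N G : nat) (net : network R M G 'I_N)
    (Hv : 'I_M -> 'I_G -> 'I_M * 'I_G -> R[i]) (lv : 'I_M * 'I_G -> nat) :
    network R M G ('I_N + 'I_M * 'I_G)%type :=
  {| bs := fun u => match u with inl n => bs net n | inr v => v.1 end;
     coef := fun m g u =>
       match u with inl n => coef net m g n | inr v => Hv m g v end;
     noise := noise net;
     rate := fun u => match u with inl n => rate net n | inr _ => 0 end;
     label := fun u => match u with inl n => label net n | inr v => lv v end |}.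

(* Not only the initial placement (m, h) |-> h: virtual users may have been
   permuted among the groups of their base station. *)
Definition one_virtual_per_group (M N G : nat)
    (pie : {ffun 'I_N + 'I_M * 'I_G -> 'I_G}) : Prop :=
  forall (m : 'I_M) (g : 'I_G), exists! h : 'I_G, pie (inr (m, h)) = g.

Definition real_grouping (M N G : nat) (pie : {ffun 'I_N + 'I_M * 'I_G -> 'I_G}) :
    {ffun 'I_N -> 'I_G} :=
  [ffun n => pie (inl n)].

(* Main.v *)
(* An exchange along distinct groups n_1, ..., n_i of one base station changes the
   channel of n_(k+1) only by adding n_k and removing n_(k+1), so it changes the
   total power by the weight of the loop n_1 -> ... -> n_i -> n_1.  An exchange
   league of real users is thus a negative loop; a shift league becomes one
   after n_i is replaced by the virtual user of its group.

   That virtual users do not affect the channel powers rests on the uniqueness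
   of the total power of a channel: given the interference, the decoding order
   minimizes the power of a group, which is therefore monotone and homogeneous in
   the effective noises (I_n + sigma^2) / |H_n|^2, while these grow less than
   proportionally with the powers. *)
Require Import Defs.
From mathcomp Require Import all_boot all_order all_algebra.
From mathcomp Require Import complex.
From mathcomp Require Import reals.
From mathcomp Require Import boolp classical_sets exp ring lra.

Set Implicit Arguments.
Unset Strict Implicit.
Unset Printing Implicit Defensive.

Import Order.TTheory GRing.Theory Num.Theory.
Local Open Scope ring_scope.

(** * Power of a single group as a function of its decoding order *)

Section StackedPower.
Variables (R : realFieldType) (U : eqType) (a : U -> R).
Implicit Types (v w p : U -> R) (s : seq U) (x y : R).
Hypothesis a_ge0 : forall n, 0 <= a n.

(* Total power of the users of s, decoded backwards along s, on top of a power x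
   of users decoded after all of them. *)
Definition stacked_power v s x : R := foldl (fun y n => y + a n * (v n + y)) x s.

Lemma stacked_power_cat v s1 s2 x :
  stacked_power v (s1 ++ s2) x = stacked_power v s2 (stacked_power v s1 x).
Proof. exact: foldl_cat. Qed.

Lemma stacked_power_rcons v s n x :
  stacked_power v (rcons s n) x =
  stacked_power v s x + a n * (v n + stacked_power v s x).
Proof. exact: foldl_rcons. Qed.

Lemma le_stacked_power v w s x y : {in s, forall n, v n <= w n} -> x <= y ->
  stacked_power v s x <= stacked_power w s y.
Proof.
elim: s x y => [|n s IHs] x y //= vw xy.
apply: IHs => [k ks|]; first by rewrite vw// in_cons ks orbT.
by rewrite lerD// ler_wpM2l// lerD// vw// mem_head.
Qed.

Lemma stacked_powerZ c v s x :
  stacked_power (fun n => c * v n) s (c * x) = c * stacked_power v s x.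
Proof.
by elim: s x => [|n s IHs] x //=; rewrite -IHs; congr foldl; ring.
Qed.

Lemma stacked_power_postpone v n s x : {in s, forall k, v n <= v k} ->
  stacked_power v (n :: s) x <= stacked_power v (rcons s n) x.
Proof.
rewrite stacked_power_rcons /=; elim: s x => [|k s IHs] x //= vn.
set x' := x + a k * (v k + x).
apply: le_trans (IHs x' _); last by move=> j js; rewrite vn// in_cons js orbT.
apply: le_stacked_power => //.
(* This product is exactly the power added when the adjacent users [n], [k] are swapped to [k],
   [n]. *)
have : 0 <= a k * a n * (v k - v n).
  by rewrite !mulr_ge0// subr_ge0 vn// mem_head.
rewrite /x'; lra.
Qed.

(** Induction on the last user [n] of [t]: in [s], all users after [n] have at least its noise, so
    moving [n] to the end cannot lower the power, and what precedes [n] is compared by induction. *)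
Lemma stacked_power_sorted_le v s t x : perm_eq s t ->
  pairwise (fun i j => v i <= v j) s -> stacked_power v s x <= stacked_power v t x.
Proof.
elim/last_ind: t s => [|t n IHt] s st; first by rewrite (perm_nilP st).
have /splitPr ns : n \in s by rewrite (perm_mem st) mem_rcons mem_head.
case: ns st => s1 s2 st.
have s12t : perm_eq (s1 ++ s2) t.
  rewrite -(perm_cons n); apply: (@perm_trans _ (s1 ++ n :: s2)).
    by rewrite -[n :: s1 ++ s2]cat1s perm_catCA.
  by rewrite (perm_trans st)// perm_rcons.
move=> sorted_s.
have sorted_s12 : pairwise (fun i j => v i <= v j) (s1 ++ s2).
  apply: subseq_pairwise sorted_s.
  by rewrite cat_subseq// subseq_cons.
have vn : {in s2, forall k, v n <= v k}.
  by move: sorted_s; rewrite pairwise_cat => /and3P[_ _ /=/andP[/allP]].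
rewrite stacked_power_rcons stacked_power_cat.
apply: le_trans (stacked_power_postpone _ vn) _.
rewrite stacked_power_rcons -stacked_power_cat.
have := IHt _ s12t sorted_s12.
by move=> le12; rewrite lerD// ler_wpM2l// lerD.
Qed.

(** Along a list ordered by [r], the sum in each user's equation runs exactly over its predecessors,
    so the implicit equations unroll into the recursion of [stacked_power]. *)
Lemma sum_stacked_power (r : rel U) v p s :
  (forall i j, r i j -> ~~ r j i) -> pairwise r s ->
  {in s, forall n, p n = a n * (v n + \sum_(i <- s | r i n) p i)} ->
  \sum_(n <- s) p n = stacked_power v s 0.
Proof.
move=> asym; elim/last_ind: s => [|s n IHs]; first by rewrite big_nil.
rewrite pairwise_rcons => /andP[/allP rn rs] ps.
rewrite big_rcons/= stacked_power_rcons -IHs//; last first.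
  move=> k ks; rewrite ps ?mem_rcons ?inE ?ks ?orbT//.
  by rewrite big_rcons_op /= (negPf (asym _ _ (rn k ks))).
rewrite ps ?mem_rcons ?mem_head// big_rcons_op/=.
have -> : r n n = false by apply/negP => rnn; move: (asym _ _ rnn); rewrite rnn.
congr (_ + _ * (_ + _)); rewrite big_seq_cond [RHS]big_seq_cond.
by apply: eq_bigl => i; case: (boolP (i \in s)) => //= /rn ->.
Qed.

End StackedPower.

(** * Uniqueness of the total power of a channel *)

Section PowerUniqueness.
Variables (R : realType) (M G : nat) (U : finType) (net : network R M G U).
Hypothesis net_valid : valid_network net.
Variables (g : 'I_G) (A : {set U}).
Implicit Types (p q : {ffun U -> R}) (m : 'I_M) (n : U).

Let coef_neq0 m h n : coef net m h n != 0. Proof. by case: net_valid. Qed.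
Let noise_gt0 : 0 < noise net. Proof. by case: net_valid. Qed.
Let label_inj : injective (label net). Proof. by case: net_valid. Qed.

Let a n := 2 `^ rate net n - 1.

Let a_ge0 n : 0 <= a n.
Proof.
have [_ _ /(_ n) rate_ge0 _] := net_valid.
have := ler_powR (ler1n R 2) (rate_ge0).
by rewrite powRr0 subr_ge0.
Qed.

(** Effective noise, the reciprocal of [sinr]: stronger users come first when [v] increases. *)
Let v p n := (interference net g A p n + noise net) / gain net (bs net n) g n.

Lemma gain_gt0 m n : 0 < gain net m g n.
Proof.
rewrite lt0r sqr_ge0 andbT expf_neq0//.
by apply: contra_neq (coef_neq0 m g n); exact: Normc.eq0_normc.
Qed.

Lemma interference_ge0 p n : is_power net g A p -> 0 <= interference net g A p n.
Proof.
move=> pP; apply: sumr_ge0 => m _; rewrite mulr_ge0 ?(ltW (gain_gt0 _ _))//.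
by apply: sumr_ge0 => j /andP[/pP[]].
Qed.

Let v_gt0 p n : is_power net g A p -> 0 < v p n.
Proof.
by move=> pP; rewrite divr_gt0 ?gain_gt0// ltr_wpDl// interference_ge0.
Qed.

Lemma sinrV p n :
  sinr net g A p n =
  ((interference net g A p n + noise net) / gain net (bs net n) g n)^-1.
Proof. by rewrite invf_div. Qed.

Lemma stronger_le p i n : is_power net g A p -> stronger net g A p i n -> v p i <= v p n.
Proof.
move=> pP; rewrite /stronger !sinrV -/(v p i) -/(v p n).
rewrite ltf_pV2 ?posrE ?v_gt0// => /orP[/ltW//|/andP[/eqP/invr_inj ->//]].
Qed.

Lemma stronger_asym p i n : stronger net g A p i n -> ~~ stronger net g A p n i.
Proof.
rewrite /stronger; case: (ltgtP (sinr net g A p n) (sinr net g A p i)) => //= _.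
by case: ltngtP.
Qed.

Lemma stronger_total p i n : i != n -> stronger net g A p i n || stronger net g A p n i.
Proof.
rewrite /stronger; case: (ltgtP (sinr net g A p n) (sinr net g A p i)) => //= _.
by rewrite -(inj_eq label_inj); case: ltngtP.
Qed.

Lemma stronger_trans p : transitive (stronger net g A p).
Proof.
move=> j i k; rewrite /stronger.
move=> /orP[ij|/andP[/eqP-> lij]] /orP[jk|/andP[/eqP <- ljk]].
- by rewrite (lt_trans jk ij).
- by rewrite ij.
- by rewrite jk.
- by rewrite eqxx (ltn_trans ljk lij) orbT.
Qed.

Lemma group_power p m : is_power net g A p ->
  exists2 s, perm_eq s (enum [set n in A | bs net n == m]) &
    pairwise (fun i j => v p i <= v p j) s /\
    \sum_(n in A | bs net n == m) p n = stacked_power a (v p) s 0.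
Proof.
move=> pP; set B := [set n in A | bs net n == m].
pose le i n := (i == n) || stronger net g A p i n.
have leT_total : total le.
  by move=> i n; rewrite /le; have [//|/(stronger_total p) in_ni] := eqVneq i n.
have leT_trans : transitive le.
  move=> j i k; rewrite /le => /orP[/eqP->//|ij] /orP[/eqP<-|jk].
    by rewrite ij orbT.
  by rewrite (stronger_trans ij jk) orbT.
exists (sort le (enum B)); first by rewrite perm_sort.
have mem_s n : (n \in sort le (enum B)) = (n \in A) && (bs net n == m).
  by rewrite mem_sort mem_enum inE.
have uniq_s : uniq (sort le (enum B)) by rewrite sort_uniq enum_uniq.
have strong_s : pairwise (stronger net g A p) (sort le (enum B)).
  have := sort_sorted leT_total (enum B); rewrite sorted_pairwise//.
  move: uniq_s; rewrite uniq_pairwise => ds ls.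
  (* In a list without repetition, the reflexive closure [le] used for sorting gives back the strict
     order. *)
  have : pairwise [rel x y | (x != y) && le x y] (sort le (enum B)).
    by rewrite pairwise_relI ds.
  by apply: sub_pairwise => i n /=; rewrite /le; case: eqVneq.
split; first by apply: sub_pairwise strong_s => i n; exact: stronger_le.
have sum_s (P : pred U) :
    \sum_(n <- sort le (enum B) | P n) p n = \sum_(n in A | (bs net n == m) && P n) p n.
  rewrite (perm_big (enum B)) ?perm_sort// big_enum_cond.
  by apply: eq_bigl => n; rewrite inE andbA.
rewrite -(sum_stacked_power (r := stronger net g A p) (p := p))//; last first.
- move=> n; rewrite mem_s => /andP[nA /eqP nm].
  by rewrite sum_s -nm; case: (pP n nA).
- exact: stronger_asym.
by rewrite (sum_s xpredT); apply: eq_bigl => n; rewrite andbT.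
Qed.

(** The solutions may have different decoding orders. That of [p] is optimal for [v p], so passing
    to the order of [q] cannot lower the power; monotonicity and homogeneity along this common order
    do the rest. *)
Lemma le_group_power p q c m : is_power net g A p -> is_power net g A q ->
  {in A, forall n, v p n <= c * v q n} ->
  \sum_(n in A | bs net n == m) p n <= c * \sum_(n in A | bs net n == m) q n.
Proof.
move=> pP qP le_v.
have [s sP [sorted_s ->]] := group_power m pP.
have [t tP [_ ->]] := group_power m qP.
rewrite -stacked_powerZ mulr0; apply: le_trans (_ : stacked_power a (v p) t 0 <= _).
  by apply: stacked_power_sorted_le => //; rewrite (perm_trans sP)// perm_sym.
apply: le_stacked_power => // n; rewrite (perm_mem tP) mem_enum inE => /andP[nA _].
exact: le_v.
Qed.

(* The powers depend monotonically on the effective noises v, and scaling all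
   powers by c > 1 scales v by less than c; so at a user where the ratio c of the
   effective noises of p and q is maximal, c > 1 is impossible. *)
Lemma le_power p q : is_power net g A p -> is_power net g A q ->
  \sum_(n in A) p n <= \sum_(n in A) q n.
Proof.
move=> pP qP.
have [->|/set0Pn[n0 n0A]] := eqVneq A finset.set0; first by rewrite !finset.big_set0.
pose ratio n := v p n / v q n.
have [n nA max_n] : exists2 n, n \in A & {in A, forall k, ratio k <= ratio n}.
  by case: (@arg_maxP _ _ _ n0 (mem A) ratio n0A) => n nA nP; exists n.
set c := ratio n in max_n.
have le_v : {in A, forall k, v p k <= c * v q k}.
  by move=> k kA; rewrite -ler_pdivrMr ?v_gt0// max_n.
have le_m := fun m => le_group_power m pP qP le_v.
have [c_le1|c_gt1] := leP c 1.
  rewrite (partition_big (bs net) xpredT)//= [leRHS](partition_big (bs net) xpredT)//=.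
  apply: ler_sum => m _; rewrite (le_trans (le_m m))// ler_piMl// sumr_ge0//.
  by move=> k /andP[/qP[]].
have le_I : interference net g A p n <= c * interference net g A q n.
  rewrite /interference mulr_sumr; apply: ler_sum => m _.
  by rewrite mulrCA ler_wpM2l// ltW// gain_gt0.
(* By the choice of [c] both sides are equal, a contradiction. Strictness comes from the positive
   noise, which is multiplied by [c] on the right only. *)
suff : v p n < c * v q n.
  by rewrite /c /ratio divfK ?ltxx// gt_eqF// v_gt0.
rewrite /v mulrA ltr_pM2r ?invr_gt0 ?gain_gt0// mulrDr ler_ltD//.
by rewrite ltr_pMl.
Qed.

Lemma chan_power_eq p : is_power net g A p -> chan_power net g A = \sum_(n in A) p n.
Proof.
move=> pP; have xP := @xgetPex _ [ffun=> 0] [set q | is_power net g A q]%classic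
  (ex_intro _ p pP).
by apply/eqP; rewrite eq_le !le_power.
Qed.

End PowerUniqueness.

Lemma chan_power0 (R : realType) (M G : nat) (U : finType) (net : network R M G U) g A :
  (forall p, ~ is_power net g A p) -> chan_power net g A = 0.
Proof.
move=> noP; rewrite /chan_power xgetPN//.
by apply: big1 => n _; rewrite ffunE.
Qed.

(** * Effect of a cyclic exchange on the total power *)

Section Exchange.
Variables (R : realType) (M G : nat) (U : finType) (net : network R M G U).
Variables (pi : {ffun U -> 'I_G}) (m : 'I_M) (s : seq U).
Hypothesis ds : differ_group net pi m s.

Let s_uniq : uniq s. Proof. by case: ds => _ /map_uniq. Qed.

Let pi_inj : {in s &, injective pi}.
Proof.
case: ds => _ us i j is_ js ij.
apply/eqP; rewrite -(nth_index i is_) -(nth_index i js) nth_uniq ?index_mem//.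
rewrite -(nth_uniq (pi i) _ _ us) ?size_map ?index_mem//.
by rewrite !(nth_map i) ?index_mem// !nth_index// ij.
Qed.

(** The channels along [s] are distinct, so no other user of [s] enters or leaves this one; the
    resulting set is the one measured by [weight]. *)
Lemma on_channel_exchange n : n \in s ->
  on_channel (exchange pi s) (pi (next s n)) =
  n |: (on_channel pi (pi (next s n)) :\ next s n).
Proof.
move=> ns; apply/setP => k; rewrite !inE ffunE.
have [ks|kNs] := boolP (k \in s).
  rewrite (inj_in_eq pi_inj) ?mem_next// (can_eq (prev_next s_uniq)).
  have [//|kn] := eqVneq k n.
  by rewrite /= (inj_in_eq pi_inj) ?mem_next// andNb.
rewrite next_nth (negPf kNs).
have -> : (k == n) = false by apply: contraNF kNs => /eqP->.
have -> // : (k == next s n) = false.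
by apply: contraNF kNs => /eqP->; rewrite mem_next.
Qed.

Lemma on_channel_exchange_notin g : g \notin [seq pi n | n <- s] ->
  on_channel (exchange pi s) g = on_channel pi g.
Proof.
move=> gNs; apply/setP => k; rewrite !inE ffunE.
have [ks|kNs] := boolP (k \in s); last by rewrite next_nth (negPf kNs).
have piNg n : n \in s -> (pi n == g) = false.
  by move=> ns; apply: contraNF gNs => /eqP <-; exact: map_f.
by rewrite !piNg ?mem_next.
Qed.

Lemma total_power_exchange :
  total_power net (exchange pi s) - total_power net pi =
  \sum_(n <- s) weight net pi n (next s n).
Proof.
pose D g := chan_power net g (on_channel (exchange pi s) g) -
            chan_power net g (on_channel pi g).
rewrite /total_power -sumrB -[LHS]/(\sum_g D g).
rewrite (bigID (mem [seq pi n | n <- s]))/= [X in _ + X]big1 ?addr0; last first.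
  by move=> g gNs; rewrite /D on_channel_exchange_notin ?subrr.
rewrite -big_uniq/=; last by case: ds.
(* [next s] permutes [s], so the sum over users who give up their place becomes a sum over those who
   take it, that is, over the edges. *)
have next_s : perm_eq [seq next s n | n <- s] s.
  apply: uniq_perm => //.
    by rewrite map_inj_uniq//; exact: can_inj (prev_next s_uniq).
  move=> n; rewrite -[in LHS](next_prev s_uniq n) mem_map ?mem_prev//.
  exact: can_inj (prev_next s_uniq).
rewrite big_map -(perm_big _ next_s) big_map.
by apply: eq_big_seq => n ns; rewrite /D on_channel_exchange.
Qed.

Lemma exchange_ge : ~ negative_differ_group_loop net pi m s ->
  total_power net pi <= total_power net (exchange pi s).
Proof.
move=> noloop; rewrite leNgt -subr_lt0; apply/negP => lt0.
(* A single user forms no cycle, as edges join different groups, but exchanging it with itself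
   changes nothing. *)
have [s_gt1|s_le1] := ltnP 1 (size s); last first.
  move: lt0; have -> : exchange pi s = pi; last by rewrite subrr ltxx.
  apply/ffunP => n; rewrite ffunE; case: s s_le1 => [|k []]//= _.
  by case: eqP => [->|].
apply: noloop; split=> //; last by rewrite -total_power_exchange.
apply: cycle_from_next => // n ns; have [bss _] := ds.
rewrite /edge /= !bss ?mem_next// !eqxx/= (inj_in_eq pi_inj) ?mem_next//.
(* With [n] rotated to the front, its successor is the head of the nonempty tail, hence differs from
   [n]. *)
have [i t st] := rot_to ns.
have t_uniq : uniq (n :: t) by rewrite -st rot_uniq.
rewrite -(next_rot i s_uniq) st.
have : size t != 0%N by rewrite -eqSS -[(size t).+1]/(size (n :: t)) -st size_rot gtn_eqF.
case: t t_uniq {st} => //= k t; rewrite eqxx inE negb_or => /andP[/andP[]//].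
Qed.

End Exchange.

(** The default of [nth] matters: past the end of [s] it returns the appended [x]. *)
Lemma next_rcons (T : eqType) (s : seq T) x y : y \in s ->
  next (rcons s x) y = nth x s (index y s).+1.
Proof.
move=> ys; rewrite next_nth mem_rcons in_cons ys orbT -cats1.
case: s ys => [//|z s] ys; rewrite index_cat ys.
have : (index y (z :: s) <= size s)%N by rewrite -ltnS index_mem.
set k := index y (z :: s) => le_s /=.
rewrite cats1 nth_rcons; case: ltngtP le_s => // [lt_s|->] _.
  exact: set_nth_default.
by rewrite nth_default.
Qed.

(** * Transfer between the real network and the one with virtual users *)

Section VirtualUsers.
Variables (R : realType) (M N G : nat) (net : network R M G 'I_N).
Variables (Hv : 'I_M -> 'I_G -> 'I_M * 'I_G -> R[i]) (lv : 'I_M * 'I_G -> nat).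
Let V := ('I_N + 'I_M * 'I_G)%type.
Let netv := with_virtual net Hv lv.
Hypothesis netv_valid : valid_network netv.

Lemma valid_network_real : valid_network net.
Proof.
case: netv_valid => coefP noiseP rateP labelP; split=> //.
- by move=> m g n; exact: (coefP m g (inl n)).
- by move=> n; exact: (rateP (inl n)).
- by move=> i j ij; have [] := labelP (inl i) (inl j) ij.
Qed.

Section ChannelPower.
Variables (g : 'I_G) (A : {set V}).
Let Ar : {set 'I_N} := inl @^-1: A.

Lemma is_power_virtual (p : {ffun V -> R}) w :
  is_power netv g A p -> inr w \in A -> p (inr w) = 0.
Proof. by move=> pP /pP[_ ->]; rewrite /= powRr0 subrr mul0r. Qed.

Section Restriction.
Variables (p : {ffun V -> R}) (q : {ffun 'I_N -> R}).
Hypothesis p_real : forall n, p (inl n) = q n.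
Hypothesis p_virtual : forall w, inr w \in A -> p (inr w) = 0.

Lemma sum_real (P : pred V) :
  \sum_(u in A | P u) p u = \sum_(n in Ar | P (inl n)) q n.
Proof.
rewrite big_sumType /= [X in _ + X]big1 ?addr0; last first.
  by move=> w /andP[wA _]; exact: p_virtual.
by apply: eq_big => // n; rewrite inE.
Qed.

Lemma interference_real n :
  interference netv g A p (inl n) = interference net g Ar q n.
Proof. by apply: eq_bigr => m _; rewrite sum_real. Qed.

Lemma stronger_real i n :
  stronger netv g A p (inl i) (inl n) = stronger net g Ar q i n.
Proof. by rewrite /stronger /sinr !interference_real. Qed.

(** Virtual users of power zero add nothing to any sum, so real users have the same equations in
    both networks; the equation of a virtual user has the factor [2 ^ 0 - 1 = 0]. *)
Lemma is_power_real : is_power netv g A p <-> is_power net g Ar q.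
Proof.
have step n : (0 <= p (inl n) /\ p (inl n) = (2 `^ rate netv (inl n) - 1) *
      ((interference netv g A p (inl n) + noise netv)
         / gain netv (bs netv (inl n)) g (inl n)
       + \sum_(i in A | (bs netv i == bs netv (inl n))
                        && stronger netv g A p i (inl n)) p i))
  <-> (0 <= q n /\ q n = (2 `^ rate net n - 1) *
      ((interference net g Ar q n + noise net) / gain net (bs net n) g n
       + \sum_(i in Ar | (bs net i == bs net n) && stronger net g Ar q i n) q i)).
  rewrite p_real interference_real sum_real.
  under [in X in X <-> _]eq_bigl do rewrite stronger_real.
  by [].
split=> [pP n nA|qP [n|w] uA].
- by apply/step/pP; rewrite inE in nA.
- by apply/step/qP; rewrite inE.
- by rewrite p_virtual//= powRr0 subrr mul0r.
Qed.

End Restriction.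

Lemma chan_power_real : chan_power netv g A = chan_power net g Ar.
Proof.
have [[p pP]|noP] := pselect (exists p, is_power netv g A p).
  pose q : {ffun 'I_N -> R} := [ffun n => p (inl n)].
  have p_real n : p (inl n) = q n by rewrite ffunE.
  have p_virtual w (wA : inr w \in A) := is_power_virtual pP wA.
  rewrite (chan_power_eq netv_valid pP).
  rewrite (chan_power_eq valid_network_real ((is_power_real p_real p_virtual).1 pP)).
  have := sum_real p_real p_virtual xpredT.
  by under eq_bigl do rewrite andbT; under [RHS]eq_bigl do rewrite andbT.
(* A solution for the real users extends by zero, so neither network has one and both powers take
   the default value 0. *)
rewrite !chan_power0// => [q qP|p pP]; apply: noP; last by exists p.
pose p : {ffun V -> R} := [ffun u => if u is inl n then q n else 0].
by exists p; apply/(is_power_real (q := q)) => // [n|w _]; rewrite ffunE.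
Qed.

End ChannelPower.

Variable pie : {ffun V -> 'I_G}.

Lemma total_power_real (f : {ffun V -> 'I_G}) :
  total_power netv f = total_power net (real_grouping f).
Proof.
apply: eq_bigr => g _; rewrite chan_power_real; congr chan_power.
by apply/setP => n; rewrite !inE ffunE.
Qed.

Lemma exchange_real (s : seq 'I_N) : uniq s ->
  real_grouping (exchange pie (map inl s)) = exchange (real_grouping pie) s.
Proof.
move=> s_uniq; apply/ffunP => n; rewrite !ffunE next_map//.
by move=> i j [].
Qed.

(** The virtual user [w] takes the place of [n] in the cycle: the last user of [s] still moves to
    the channel of [n], [n] itself stays, and the closing move of [w] is invisible to real users. *)
Lemma shift_real (s : seq 'I_N) n w : uniq (rcons s n) ->
  pie (inr w) = pie (inl n) ->
  real_grouping (exchange pie (rcons (map inl s) (inr w))) =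
  shift (real_grouping pie) (rcons s n).
Proof.
rewrite rcons_uniq => /andP[nNs s_uniq] wn; apply/ffunP => k; rewrite !ffunE last_rcons.
have inl_inj : injective (@inl 'I_N ('I_M * 'I_G)) by move=> i j [].
have mem_inl i : ((inl i : V) \in [seq inl j | j <- s]) = (i \in s).
  exact: mem_map.
have [->|kn] := eqVneq k n.
  by rewrite next_nth mem_rcons in_cons/= mem_inl (negPf nNs).
have [ks|kNs] := boolP (k \in s); last first.
  by rewrite !next_nth !mem_rcons !in_cons mem_inl (negPf kn) (negPf kNs).
rewrite !next_rcons ?mem_inl// index_map//.
have [lt_ks|le_sk] := ltnP (index k s).+1 (size s).
  by rewrite (nth_map n).
(* For the last user of [s] the two defaults are [inr w] and [n], which share a channel. *)
by rewrite !nth_default ?size_map.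
Qed.

Lemma differ_group_real (m : 'I_M) (s : seq 'I_N) :
  differ_group net (real_grouping pie) m s ->
  differ_group netv pie m (map inl s).
Proof.
case=> bs_s pi_s; split=> [_ /mapP[n ns ->]|]; first exact: bs_s.
rewrite -map_comp (eq_map (g := real_grouping pie))// => n.
by rewrite /real_grouping ffunE.
Qed.

Lemma differ_group_rcons_virtual (m : 'I_M) (s : seq 'I_N) n h :
  pie (inr (m, h)) = pie (inl n) ->
  differ_group net (real_grouping pie) m (rcons s n) ->
  differ_group netv pie m (rcons (map inl s) (inr (m, h))).
Proof.
move=> hn /differ_group_real[bs_s]; rewrite !map_rcons => pi_s; split.
  move=> u; rewrite mem_rcons in_cons => /predU1P[->//|us].
  by apply: bs_s; rewrite map_rcons mem_rcons in_cons us orbT.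
by rewrite map_rcons hn.
Qed.

End VirtualUsers.

Theorem theorem3 (R : realType) (M N G : nat) (net : network R M G 'I_N)
    (Hv : 'I_M -> 'I_G -> 'I_M * 'I_G -> R[i]) (lv : 'I_M * 'I_G -> nat)
    (pie : {ffun 'I_N + 'I_M * 'I_G -> 'I_G}) :
  valid_network (with_virtual net Hv lv) ->
  feasible (with_virtual net Hv lv) ->
  one_virtual_per_group pie ->
  (forall (m : 'I_M) (s : seq ('I_N + 'I_M * 'I_G)),
     ~ negative_differ_group_loop (with_virtual net Hv lv) pie m s) ->
  all_stable net (real_grouping pie).
Proof.
move=> netv_valid _ virtualP noloop i /andP[i_gt0 _] m s; split=> -[size_s ds].
- case/lastP: s => [|s n] in size_s ds *; first by rewrite -size_s in i_gt0.
  (* The virtual user in the group of the last user [n] closes the shift into a loop. *)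
  have [h [hn _]] := virtualP m (pie (inl n)).
  have s_uniq := map_uniq ds.2.
  rewrite -(shift_real s_uniq hn) -!(total_power_real netv_valid) ltNge.
  by rewrite (exchange_ge (differ_group_rcons_virtual Hv lv hn ds)).
- rewrite -exchange_real ?(map_uniq ds.2)// -!(total_power_real netv_valid) ltNge.
  by rewrite (exchange_ge (differ_group_real Hv lv ds)).
Qed.
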